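(* Suppose $G$ is a simple graph with $n$ vertices and $k>1$ connected components. If $\Phi=\{\phi_i\}_{i\in[n]}$ is an $L_G(n,n-k)$-frame for $\mathbb{C}^{n-k}$ with frame operator $S_\Phi$, then the canonical dual frame $S_\Phi^{-1}\Phi$ of $\Phi$ is a spectrally optimal dual frame of $\Phi$ for $2$-erasures. Further, $\rho^{(2)}_\Phi=1$.
   Context: Write $[n]=\{1,\dots,n\}$; inner products on $\mathbb{C}^d$ are standard and linear in the first argument. A finite sequence $\Phi=\{\phi_i\}_{i\in[n]}$ in $\mathbb{C}^d$ is a frame for $\mathbb{C}^d$ if there are constants $0<A\le B$ with $A\|f\|^2\le\sum_{i\in[n]}|\langle f,\phi_i\rangle|^2\le B\|f\|^2$ for all $f\in\mathbb{C}^d$. Its frame operator is $S_\Phi f=\sum_{i\in[n]}\langle f,\phi_i\rangle\phi_i$ (invertible). A frame $\Psi=\{\psi_i\}_{i\in[n]}$ of $\mathbb{C}^d$ is a dual frame of $\Phi$ if $f=\sum_{i\in[n]}\langle f,\phi_i\rangle\psi_i=\sum_{i\in[n]}\langle f,\psi_i\rangle\phi_i$ for all $f\in\mathbb{C}^d$; $D_\Phi$ denotes the set of dual frames of $\Phi$. The canonical dual frame of $\Phi$ is $S_\Phi^{-1}\Phi:=\{S_\Phi^{-1}\phi_i\}_{i\in[n]}\in D_\Phi$. Spectral optimality: for $\Psi\in D_\Phi$ and $\Lambda\subset[n]$, the error operator is $E_{\Phi,\Psi,\Lambda}(f)=\sum_{i\in\Lambda}\langle f,\phi_i\rangle\psi_i$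 on $\mathbb{C}^d$, and for $1\le r<n$, $\rho^{(r)}_{\Phi,\Psi}:=\max\{\rho(E_{\Phi,\Psi,\Lambda}):\Lambda\subset[n],\ |\Lambda|=r\}$, where $\rho(\cdot)$ is the spectral radius. Put $\rho^{(r)}_\Phi:=\min\{\rho^{(r)}_{\Phi,\widetilde\Psi}:\widetilde\Psi\in D_\Phi\}$. $\Psi\in D_\Phi$ is a spectrally optimal dual frame of $\Phi$ for $1$-erasure if $\rho^{(1)}_{\Phi,\Psi}=\rho^{(1)}_\Phi$. $\Psi$ is a spectrally optimal dual frame of $\Phi$ for $2$-erasures if it is a spectrally optimal dual frame for $1$-erasure and $\rho^{(2)}_{\Phi,\Psi}=\rho^{(2)}_\Phi$ (the minimum being over all of $D_\Phi$). Graph frames: for a simple graph $G$ with $n$ vertices $v_1,\dots,v_n$ and $n-m$ connected components, the Laplacian matrix is $L(G)=D(G)-A(G)$ (degree matrix minus adjacency matrix); it has rank $m$. Write $L(G)=M\,\mathrm{diag}(\lambda_1,\dots,\lambda_m,0,\dots,0)\,M^*$ with $M$ unitary and $\lambda_1,\dots,\lambda_m$ the nonzero eigenvalues, let $M_1$ be the submatrix formed by the first $m$ columns of $M$, and let $B=\mathrm{diag}(\sqrt{\lambda_1},\dots,\sqrt{\lambda_m})M_1^*$. Then $\{B e_i\}_{i\in[n]}$, with $\{e_i\}$ the standard basis of $\mathbb{C}^n$, is a frame for $\mathbb{C}^m$; any frame arising in this way is called an $L_G(n,m)$-frame. *)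

(* Defs.v *)
From HB Require Import structures.
From mathcomp Require Import all_boot all_order all_algebra.
From mathcomp Require Import complex.
From mathcomp Require Import boolp classical_sets reals.

Set Implicit Arguments.
Unset Strict Implicit.
Unset Printing Implicit Defensive.

Import Order.TTheory GRing.Theory Num.Theory.

Local Open Scope ring_scope.
Local Open Scope sesquilinear_scope.
Local Open Scope classical_set_scope.
Local Open Scope complex_scope.

Section Frames.
Variables (R : realType) (d n : nat).
Implicit Types (f g : 'cV[R[i]]_d) (Phi Psi : 'I_n -> 'cV[R[i]]_d).
Implicit Types (T : 'End('cV[R[i]]_d)) (Lam : {set 'I_n}).

(* modulus, as an element of R (the library norm `|z| lives in R[i]) *)
Definition cmod (z : R[i]) : R := ComplexField.Normc.normc z.

Definition inner f g : R[i] := \sum_(j < d) f j 0 * (g j 0)^*.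

Definition sqnorm f : R := \sum_(j < d) cmod (f j 0) ^+ 2.

Definition is_frame Phi : Prop :=
  exists A B : R, [/\ 0 < A, A <= B &
    forall f, A * sqnorm f <= \sum_(i < n) cmod (inner f (Phi i)) ^+ 2
              /\ \sum_(i < n) cmod (inner f (Phi i)) ^+ 2 <= B * sqnorm f].

(* linfun g agrees with g only when g is linear; see err_opE, frame_opE. *)
Definition err_fun Phi Psi Lam f : 'cV[R[i]]_d :=
  \sum_(i in Lam) inner f (Phi i) *: Psi i.

Definition err_op Phi Psi Lam : 'End('cV[R[i]]_d) :=
  linfun (err_fun Phi Psi Lam).

Definition frame_fun Phi f : 'cV[R[i]]_d :=
  \sum_(i < n) inner f (Phi i) *: Phi i.

Definition frame_op Phi : 'End('cV[R[i]]_d) := linfun (frame_fun Phi).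

Definition dual_frames Phi : set ('I_n -> 'cV[R[i]]_d) :=
  [set Psi | is_frame Psi /\
     forall f, f = \sum_(i < n) inner f (Phi i) *: Psi i
               /\ f = \sum_(i < n) inner f (Psi i) *: Phi i].

(* _^-1%VF is only a right inverse on the image in general; the frame operator
   of a frame is bijective, and there it is the inverse. *)
Definition canonical_dual Phi : 'I_n -> 'cV[R[i]]_d :=
  fun i => (frame_op Phi)^-1%VF (Phi i).

(* For 0 < d the set of moduli is finite and nonempty, so sup is a maximum. *)
Definition spectral_radius T : R :=
  sup [set cmod a | a in [set a : R[i] | passmx.leigenvalue T a]].

(* Moduli are nonnegative, so the default 0 is harmless when r <= n. *)
Definition rho_dual (r : nat) Phi Psi : R :=
  \big[Num.max/0]_(Lam : {set 'I_n} | #|Lam| == r)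
    spectral_radius (err_op Phi Psi Lam).

(* The paper's minimum over all dual frames, as an infimum: it is a minimum
   exactly when some Psi in dual_frames Phi has rho_dual r Phi Psi equal to it,
   which is what the optimality predicates below assert. *)
Definition rho_frame (r : nat) Phi : R :=
  inf [set rho_dual r Phi Psi | Psi in dual_frames Phi].

Definition spectrally_optimal1 Phi Psi : Prop :=
  dual_frames Phi Psi /\ rho_dual 1 Phi Psi = rho_frame 1 Phi.

Definition spectrally_optimal2 Phi Psi : Prop :=
  spectrally_optimal1 Phi Psi /\ rho_dual 2 Phi Psi = rho_frame 2 Phi.

Lemma innerP a f1 f2 g : inner (a *: f1 + f2) g = a * inner f1 g + inner f2 g.
Proof.
rewrite /inner mulr_sumr -big_split; apply: eq_bigr => j _ /=.
by rewrite !mxE mulrDl mulrA.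
Qed.

Lemma err_opE Phi Psi Lam f :
  err_op Phi Psi Lam f = \sum_(i in Lam) inner f (Phi i) *: Psi i.
Proof.
have lin : linear (err_fun Phi Psi Lam).
  move=> a f1 f2; rewrite /err_fun scaler_sumr -big_split.
  by apply: eq_bigr => i _ /=; rewrite innerP scalerDl scalerA.
pose m := GRing.isLinear.Build _ _ _ _ _ lin.
pose h : {linear 'cV[R[i]]_d -> 'cV[R[i]]_d} := HB.pack (err_fun Phi Psi Lam) m.
exact: (lfunE h f).
Qed.

Lemma frame_opE Phi f :
  frame_op Phi f = \sum_(i < n) inner f (Phi i) *: Phi i.
Proof.
have -> : frame_op Phi = err_op Phi Phi [set: 'I_n]%SET.
  rewrite /frame_op /err_op; congr linfun; apply/funext => g.
  by apply: eq_bigl => i; rewrite inE.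
by rewrite err_opE; apply: eq_bigl => i; rewrite inE.
Qed.

End Frames.

Section GraphFrames.
Variables (R : realType) (n : nat) (e : rel 'I_n).

Definition degree_mx : 'M[R[i]]_n := diag_mx (\row_i #|[pred j | e i j]|%:R).
Definition adjacency_mx : 'M[R[i]]_n := \matrix_(i, j) (e i j)%:R.
Definition laplacian_mx : 'M[R[i]]_n := degree_mx - adjacency_mx.

(* Phi is an L_G(n,m)-frame.  The diagonal lam has nonzero entries exactly in
   its first m positions; colsub (widen_ord le_mn) keeps the first m columns. *)
Definition is_graph_frame (m : nat) (Phi : 'I_n -> 'cV[R[i]]_m) : Prop :=
  exists (le_mn : (m <= n)%N) (M : 'M[R[i]]_n) (lam : 'rV[R[i]]_n),
    let M1 := colsub (widen_ord le_mn) M in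
    let lam1 := colsub (widen_ord le_mn) lam in
    let B := diag_mx (map_mx sqrtC lam1) *m M1 ^t* in
    [/\ M \is unitarymx,
        laplacian_mx = M *m diag_mx lam *m M ^t*,
        forall i : 'I_n, (lam 0 i != 0) = (i < m)%N &
        forall i : 'I_n, Phi i = B *m delta_mx i 0].

End GraphFrames.

(* Main.v *)
(* For an L_G-frame, <phi_j, phi_i> = L(G)_ij.  Hence the phi_l of one connected component
   sum to 0, and for i, j in the same component there is f with <f, phi_l> = 1 at l = i,
   -1 at l = j and 0 elsewhere.  Every dual Psi then has psi_i - psi_j = f.
   - One erasure: the sum of <psi_l, phi_l> over a component is the same for all duals, and
     for the canonical dual the summands are equal, so its largest modulus is minimal.
   - Two erasures: the error operator of {i, j} fixes f for every dual, so the spectral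
     radius is at least 1, while for the canonical dual the eigenvalues of every error
     operator lie in [0, 1]. *)
Require Import Defs.
From mathcomp Require Import all_boot all_order all_algebra complex.
From mathcomp Require Import ring.
From mathcomp Require Import boolp classical_sets reals.

Set Implicit Arguments.
Unset Strict Implicit.
Unset Printing Implicit Defensive.

Import Order.TTheory GRing.Theory Num.Theory.
Local Open Scope complex_scope.
Local Open Scope ring_scope.

(** * The real-valued modulus on complex numbers *)

Section Modulus.
Variable R : realType.
Implicit Types (z w : R[i]).

Lemma normE z : `|z| = (cmod z)%:C.
Proof. by []. Qed.

Lemma cmod_ge0 z : 0 <= cmod z.
Proof. by rewrite -lecR -normE normr_ge0. Qed.

Lemma cmod0 : cmod 0 = 0 :> R.
Proof. exact: ComplexField.Normc.normc0. Qed.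

Lemma cmod1 : cmod 1 = 1 :> R.
Proof. exact: ComplexField.Normc.normc1. Qed.

Lemma cmodM z w : cmod (z * w) = cmod z * cmod w.
Proof. exact: ComplexField.Normc.normcM. Qed.

Lemma cmodMn z k : cmod (z *+ k) = k%:R * cmod z.
Proof. by apply: (@complexI R); rewrite -normE normrMn rmorphM rmorph_nat mulr_natl. Qed.

Lemma cmod_eq0 z : (cmod z == 0) = (z == 0).
Proof.
by apply/eqP/eqP => [/ComplexField.Normc.eq0_normc|->] //; exact: cmod0.
Qed.

Lemma cmod_conj z : cmod z^* = cmod z.
Proof.
by apply/eqP; rewrite -(inj_eq (@complexI R)); apply/eqP; rewrite -!normE norm_conjC.
Qed.

Lemma sqr_cmod z : (cmod z ^+ 2)%:C = z * z^*.
Proof. by rewrite rmorphXn /= -normE normCK. Qed.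

Lemma cmod_sum (I : finType) (P : pred I) (F : I -> R[i]) :
  cmod (\sum_(i | P i) F i) <= \sum_(i | P i) cmod (F i).
Proof.
by rewrite -lecR -normE rmorph_sum; exact: ler_norm_sum.
Qed.

(** A crude Cauchy-Schwarz bound: every [cmod (a i)] is at most the square root of [q]. The l1 norm
    of [b] suffices, since only the finiteness of the constants built from it matters. *)
Lemma sqr_cmod_sumM (I : finType) (a b : I -> R[i]) :
  cmod (\sum_i a i * b i) ^+ 2
    <= (\sum_i cmod (a i) ^+ 2) * (\sum_i cmod (b i)) ^+ 2.
Proof.
set q := \sum_i cmod (a i) ^+ 2.
have q0 : 0 <= q by apply: sumr_ge0 => i _; rewrite sqr_ge0.
have aq i : cmod (a i) <= Num.sqrt q.
  rewrite -(ger0_norm (cmod_ge0 (a i))) -sqrtr_sqr ler_sqrt //.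
  rewrite /q (bigD1 i) //= lerDl.
  by apply: sumr_ge0 => j _; rewrite sqr_ge0.
rewrite -[X in X * _](sqr_sqrtr q0) -exprMn.
rewrite ler_pXn2r ?nnegrE ?cmod_ge0 ?mulr_ge0 ?sqrtr_ge0 //; last first.
  by apply: sumr_ge0 => i _; rewrite cmod_ge0.
apply: (le_trans (cmod_sum _ _)); rewrite mulr_sumr; apply: ler_sum => i _.
by rewrite cmodM ler_wpM2r // cmod_ge0.
Qed.

End Modulus.

(** * The inner product and the squared norm *)

Section InnerProduct.
Variables (R : realType) (d : nat).
Implicit Types (f g : 'cV[R[i]]_d).

Lemma innerC f g : inner g f = (inner f g)^*.
Proof.
rewrite /inner rmorph_sum; apply: eq_bigr => j _.
by rewrite rmorphM /= conjCK mulrC.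
Qed.

Lemma inner0l g : inner 0 g = 0.
Proof. by rewrite /inner big1 // => j _; rewrite mxE mul0r. Qed.

Lemma innerDl f1 f2 g : inner (f1 + f2) g = inner f1 g + inner f2 g.
Proof. by rewrite -[f1 in LHS]scale1r innerP mul1r. Qed.

Lemma innerZl a f g : inner (a *: f) g = a * inner f g.
Proof. by rewrite -[_ *: _]addr0 innerP inner0l addr0. Qed.

Lemma innerBl f1 f2 g : inner (f1 - f2) g = inner f1 g - inner f2 g.
Proof. by rewrite innerDl -scaleN1r innerZl mulN1r. Qed.

Lemma inner_suml (I : finType) (P : pred I) (F : I -> 'cV[R[i]]_d) g :
  inner (\sum_(i | P i) F i) g = \sum_(i | P i) inner (F i) g.
Proof. by apply: (big_morph _ (fun x y => innerDl x y g) (inner0l g)). Qed.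

Lemma inner_sumr (I : finType) (P : pred I) (F : I -> 'cV[R[i]]_d) f :
  inner f (\sum_(i | P i) F i) = \sum_(i | P i) inner f (F i).
Proof.
rewrite innerC inner_suml rmorph_sum; apply: eq_bigr => i _ /=.
by rewrite -innerC.
Qed.

Lemma sqnorm_ge0 f : 0 <= sqnorm f.
Proof. by apply: sumr_ge0 => j _; rewrite sqr_ge0. Qed.

Lemma sqnorm_eq0 f : (sqnorm f == 0) = (f == 0).
Proof.
apply/eqP/eqP => [/eqP|->]; last first.
  by rewrite /sqnorm big1 // => j _; rewrite mxE cmod0 expr0n.
rewrite psumr_eq0 => [/allP f0|j _]; last by rewrite sqr_ge0.
apply/matrixP => j k; rewrite ord1 mxE; apply/eqP.
by rewrite -cmod_eq0 -(sqrf_eq0 (cmod _)); apply: f0; rewrite mem_index_enum.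
Qed.

Lemma sqnormZ a f : sqnorm (a *: f) = cmod a ^+ 2 * sqnorm f.
Proof.
rewrite /sqnorm mulr_sumr; apply: eq_bigr => j _.
by rewrite mxE cmodM exprMn.
Qed.

Lemma sqr_inner_le f g :
  cmod (inner f g) ^+ 2 <= sqnorm f * (\sum_j cmod (g j 0)) ^+ 2.
Proof.
apply: (le_trans (sqr_cmod_sumM _ _)); apply: ler_wpM2l; first exact: sqnorm_ge0.
by under eq_bigr do rewrite cmod_conj.
Qed.

End InnerProduct.

(** * Eigenvalues and the spectral radius *)

Section Spectrum.
Variables (R : realType) (d : nat).
Implicit Types (T : 'End('cV[R[i]]_d)) (f g : 'cV[R[i]]_d).

Lemma leigenvalueP T (a : R[i]) :
  reflect (exists2 f, T f = a *: f & f != 0) (passmx.leigenvalue T a).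
Proof.
have memE f : (f \in passmx.leigenspace T a) = (T f == a *: f).
  by rewrite memv_ker !lfun_simp subr_eq0.
rewrite /passmx.leigenvalue -vpick0; apply: (iffP idP) => [Ta|[f Tf f0]].
  by exists (vpick (passmx.leigenspace T a)) => //; apply/eqP; rewrite -memE memv_pick.
rewrite vpick0; apply: contraNneq f0 => Ta0.
by rewrite -memv0 -Ta0 memE Tf.
Qed.

(** Boundedness of [T] bounds its eigenvalues, so that [sup] in [spectral_radius] is a true upper
    bound. *)
Lemma sqnorm_lfun_le T : exists2 K : R, 0 <= K & forall f, sqnorm (T f) <= K * sqnorm f.
Proof.
exists (\sum_k (\sum_j cmod (T (delta_mx j 0) k 0)) ^+ 2).
  by apply: sumr_ge0 => k _; rewrite sqr_ge0.
move=> f; rewrite mulr_suml; apply: ler_sum => k _; rewrite mulrC.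
have -> : T f k 0 = \sum_j f j 0 * T (delta_mx j 0) k 0.
  rewrite {1}[f]matrix_sum_delta linear_sum summxE; apply: eq_bigr => j _.
  by rewrite big_ord1 linearZ /= mxE.
exact: sqr_cmod_sumM.
Qed.

Lemma spectral_radius_ge T a f :
  T f = a *: f -> f != 0 -> cmod a <= spectral_radius T.
Proof.
move=> Tf f0; apply: ub_le_sup; last first.
  by exists a => //=; apply/leigenvalueP; exists f.
have [K K0 TK] := sqnorm_lfun_le T.
exists (1 + K) => _ [b /= /leigenvalueP [g Tg g0] <-].
have g_gt0 : 0 < sqnorm g by rewrite lt_def sqnorm_ge0 sqnorm_eq0 g0.
have bK : cmod b ^+ 2 <= K by rewrite -(ler_pM2r g_gt0) -sqnormZ -Tg TK.
(* The bound on the square passes to the modulus: it is at most 1, or at most its own square. *)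
have [b1|/ltW b1] := leP (cmod b) 1; first by rewrite (le_trans b1) // lerDl.
by apply: le_trans (ler_eXnr _ b1) (le_trans bK _); rewrite ?lerDr.
Qed.

Lemma spectral_radius_le T b : 0 <= b ->
    (forall a f, f != 0 -> T f = a *: f -> cmod a <= b) ->
  spectral_radius T <= b.
Proof.
move=> b0 Tb; rewrite /spectral_radius.
(* With no eigenvalue ([d = 0]), [sup] takes its default value 0, whence the assumption [0 <= b]. *)
have [->|/set0P A0] :=
  eqVneq [set cmod a | a in [set a | passmx.leigenvalue T a]]%classic set0.
  by rewrite sup0.
by apply: ge_sup => // _ [a /= /leigenvalueP [f Tf f0] <-]; exact: Tb Tf.
Qed.

Lemma spectral_radius_ge0 T : 0 <= spectral_radius T.
Proof.
rewrite /spectral_radius.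
have [->|/set0P [_ [a /= Ta _]]] :=
  eqVneq [set cmod a | a in [set a | passmx.leigenvalue T a]]%classic set0.
  by rewrite sup0.
have /leigenvalueP [f Tf f0] := Ta.
exact: le_trans (cmod_ge0 a) (spectral_radius_ge Tf f0).
Qed.

End Spectrum.

(** * Worst-case errors and the rank-one case *)

Section Erasures.
Variables (R : realType) (d n : nat).
Implicit Types (Phi Psi : 'I_n -> 'cV[R[i]]_d) (Lam : {set 'I_n}).

Lemma rho_dual_ge r Phi Psi Lam : #|Lam| = r ->
  spectral_radius (err_op Phi Psi Lam) <= rho_dual r Phi Psi.
Proof. by move=> Lr; apply: le_bigmax_cond; rewrite Lr. Qed.

Lemma rho_dual_ge0 r Phi Psi : 0 <= rho_dual r Phi Psi.
Proof. exact: bigmax_ge_id. Qed.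

(** Turns the infimum into an attained minimum; [inf] is meaningful here because the set is nonempty
    and bounded below by 0. *)
Lemma rho_frame_min r Phi Psi0 : dual_frames Phi Psi0 ->
    (forall Psi, dual_frames Phi Psi -> rho_dual r Phi Psi0 <= rho_dual r Phi Psi) ->
  rho_dual r Phi Psi0 = rho_frame r Phi.
Proof.
move=> D0 Dmin; apply: le_anti; apply/andP; split.
  apply: lb_le_inf; first by exists (rho_dual r Phi Psi0), Psi0.
  by move=> _ [Psi DPsi <-]; exact: Dmin.
apply: ge_inf; last by exists Psi0.
by exists 0 => _ [Psi _ <-]; exact: rho_dual_ge0.
Qed.

Lemma err_op1 Phi Psi i f : err_op Phi Psi [set i] f = inner f (Phi i) *: Psi i.
Proof. by rewrite err_opE big_set1. Qed.

(** The operator has rank at most one; its only possible nonzero eigenvalue is its trace, with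
    eigenvector [Psi i]. *)
Lemma spectral_radius1 Phi Psi i :
  spectral_radius (err_op Phi Psi [set i]) = cmod (inner (Psi i) (Phi i)).
Proof.
apply: le_anti; apply/andP; split.
  apply: spectral_radius_le => [|a f f0]; first exact: cmod_ge0.
  rewrite err_op1 => Ef.
  have [->|a0] := eqVneq a 0; first by rewrite cmod0 cmod_ge0.
  have c0 : inner f (Phi i) != 0.
    apply: contraNneq f0 => c0; move/eqP: Ef.
    by rewrite c0 scale0r eq_sym scaler_eq0 (negPf a0).
  suff -> : a = inner (Psi i) (Phi i) by [].
  (* Pairing the eigenvalue equation with [Phi i] leaves the nonzero factor [inner f (Phi i)] on
     both sides. *)
  have := congr1 (fun g => inner g (Phi i)) Ef.
  by rewrite !innerZl mulrC => /(mulIf c0).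
have [P0|P0] := eqVneq (Psi i) 0; last by apply: (spectral_radius_ge _ P0); rewrite err_op1.
by rewrite P0 inner0l cmod0; exact: spectral_radius_ge0.
Qed.

End Erasures.

(** * The frame operator and the canonical dual *)

Section CanonicalDual.
Variables (R : realType) (d n : nat).
Implicit Types (f g : 'cV[R[i]]_d) (Psi : 'I_n -> 'cV[R[i]]_d).

Lemma sqnorm_le_coefs Psi f (c : 'I_n -> R[i]) :
    f = \sum_i c i *: Psi i ->
  sqnorm f <= (\sum_i cmod (c i) ^+ 2) * \sum_j (\sum_i cmod (Psi i j 0)) ^+ 2.
Proof.
move=> fE; rewrite mulr_sumr; apply: ler_sum => j _.
have -> : f j 0 = \sum_i c i * Psi i j 0.
  by rewrite fE summxE; apply: eq_bigr => i _; rewrite mxE.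
exact: sqr_cmod_sumM.
Qed.

(** Expanding [f] in the [Phi i] gives the lower frame bound; the upper one holds for any finite
    family. *)
Lemma is_frame_of_reconstruction Phi Psi :
  (forall f, f = \sum_(i < n) inner f (Psi i) *: Phi i) -> is_frame Psi.
Proof.
move=> rec.
pose a : R := \sum_j (\sum_i cmod (Phi i j 0)) ^+ 2.
pose b : R := \sum_i (\sum_j cmod (Psi i j 0)) ^+ 2.
have a0 : 0 <= a by apply: sumr_ge0 => j _; rewrite sqr_ge0.
have b0 : 0 <= b by apply: sumr_ge0 => j _; rewrite sqr_ge0.
have a1 : 0 < 1 + a by rewrite ltr_pwDl.
(* Adding 1 makes the constant invertible even if [a = 0]; the summand [(1 + a)^-1] in the second
   bound ensures that it dominates the first. *)
exists (1 + a)^-1, ((1 + a)^-1 + b); split; first by rewrite invr_gt0.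
  by rewrite lerDl.
move=> f; have f0 := sqnorm_ge0 f; split.
  rewrite mulrC ler_pdivrMr // (le_trans (sqnorm_le_coefs (rec f))) //.
  by rewrite ler_wpM2l ?lerDr // sumr_ge0 // => i _; rewrite sqr_ge0.
apply: (@le_trans _ _ (b * sqnorm f)).
  by rewrite mulr_suml; apply: ler_sum => i _; rewrite mulrC sqr_inner_le.
by rewrite ler_wpM2r // lerDr invr_ge0 ltW.
Qed.

Variable Phi : 'I_n -> 'cV[R[i]]_d.
(** In finite dimension this says that the [Phi i] span, which amounts to being a frame. *)
Hypothesis Phi_total : forall f, (forall i, inner f (Phi i) = 0) -> f = 0.

Lemma inner_frame_op f g :
  inner (frame_op Phi f) g = \sum_i inner f (Phi i) * (inner g (Phi i))^*.
Proof.
by rewrite frame_opE inner_suml; apply: eq_bigr => i _; rewrite innerZl -innerC.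
Qed.

Lemma frame_op_selfadjoint f g : inner (frame_op Phi f) g = inner f (frame_op Phi g).
Proof.
rewrite [RHS]innerC !inner_frame_op rmorph_sum; apply: eq_bigr => i _.
by rewrite rmorphM /= conjCK mulrC.
Qed.

Lemma analysis_sqr_eq0 f : \sum_i cmod (inner f (Phi i)) ^+ 2 = 0 -> f = 0.
Proof.
move/eqP; rewrite psumr_eq0 => [/allP f0|j _]; last by rewrite sqr_ge0.
apply: Phi_total => i; apply/eqP.
by rewrite -cmod_eq0 -(sqrf_eq0 (cmod _)); apply: f0; rewrite mem_index_enum.
Qed.

Lemma inner_frame_op_self f :
  inner (frame_op Phi f) f = (\sum_i cmod (inner f (Phi i)) ^+ 2)%:C.
Proof.
rewrite inner_frame_op rmorph_sum; apply: eq_bigr => i _ /=.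
by rewrite sqr_cmod.
Qed.

(** If [S f = 0], then [inner (S f) f], the sum of the squared moduli of the coefficients of [f],
    vanishes, so [f = 0] by totality. *)
Lemma lker_frame_op : lker (frame_op Phi) == 0%VS.
Proof.
apply/lker0P => f g Sfg; apply/eqP; rewrite -subr_eq0; apply/eqP.
apply: analysis_sqr_eq0; apply: (@complexI R).
by rewrite -inner_frame_op_self linearB /= Sfg subrr inner0l.
Qed.

Lemma canonical_dualE i : frame_op Phi (canonical_dual Phi i) = Phi i.
Proof. exact: lker0_lfunVK lker_frame_op _. Qed.

Lemma inner_canonical_dual f i :
  inner (frame_op Phi f) (canonical_dual Phi i) = inner f (Phi i).
Proof. by rewrite frame_op_selfadjoint canonical_dualE. Qed.

Lemma canonical_dual_inner_sym i j :
  inner (canonical_dual Phi i) (Phi j) = inner (Phi i) (canonical_dual Phi j).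
Proof. by rewrite -(canonical_dualE i) inner_canonical_dual. Qed.

(** One reconstruction formula is [S (S^-1 f) = f], with the inverse moved across the inner product;
    the other follows after applying the injective [S]. *)
Lemma canonical_dualP : dual_frames Phi (canonical_dual Phi).
Proof.
have S_inj := lker0P lker_frame_op.
have rec f : f = \sum_i inner f (canonical_dual Phi i) *: Phi i.
  rewrite -{1}(lker0_lfunVK lker_frame_op f) frame_opE; apply: eq_bigr => i _.
  by rewrite -[in LHS]inner_canonical_dual lker0_lfunVK // lker_frame_op.
split=> [|f]; first exact: is_frame_of_reconstruction rec.
split=> //; apply: S_inj; rewrite frame_opE linear_sum; apply: eq_bigr => i _.
by rewrite linearZ /= canonical_dualE.
Qed.

(* Pairing E f = a f with S f gives a sum_i |<f, phi_i>|^2 = sum_(i in Lam) |<f, phi_i>|^2,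
   so a lies in [0, 1]. *)
Lemma canonical_spectral_radius_le1 (Lam : {set 'I_n}) :
  spectral_radius (err_op Phi (canonical_dual Phi) Lam) <= 1.
Proof.
apply: spectral_radius_le => // a f f0 Ef.
pose s (A : {set 'I_n}) : R := \sum_(i in A) cmod (inner f (Phi i)) ^+ 2.
have s_ge0 A : 0 <= s A by apply: sumr_ge0 => i _; rewrite sqr_ge0.
have sT : s [set: 'I_n]%SET = \sum_i cmod (inner f (Phi i)) ^+ 2.
  by apply: eq_bigl => i; rewrite inE.
have sT_gt0 : 0 < s [set: 'I_n]%SET.
  rewrite lt_def s_ge0 andbT; apply: contraNneq f0; rewrite sT.
  by move=> /analysis_sqr_eq0 ->.
have aE : a * (s [set: 'I_n]%SET)%:C = (s Lam)%:C.
  rewrite sT -inner_frame_op_self frame_op_selfadjoint -innerZl -Ef err_opE.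
  rewrite inner_suml rmorph_sum; apply: eq_bigr => i _ /=.
  rewrite innerZl -frame_op_selfadjoint canonical_dualE sqr_cmod.
  by rewrite -innerC.
rewrite -(ler_pM2r sT_gt0) mul1r -lecR rmorphM /= -normE.
rewrite -[X in _ * X]ger0_norm ?lecR // -normrM aE ger0_norm ?lecR //.
rewrite sT /s [leRHS](bigID (mem Lam)) /= lerDl.
by apply: sumr_ge0 => i _; rewrite sqr_ge0.
Qed.

Lemma canonical_rho_dual_le1 r : rho_dual r Phi (canonical_dual Phi) <= 1.
Proof. by apply: bigmax_le => // Lam _; exact: canonical_spectral_radius_le1. Qed.

End CanonicalDual.

(** * The quadratic form and kernel of the graph Laplacian *)

Section Laplacian.
Variables (R : realType) (n : nat) (e : rel 'I_n).
Hypothesis e_sym : symmetric e.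
Implicit Types v : 'I_n -> R[i].

Lemma laplacian_sum v i :
  \sum_j laplacian_mx R e i j * v j = \sum_j (e i j)%:R * (v i - v j).
Proof.
have LE j : laplacian_mx R e i j * v j =
    (if j == i then #|[pred j | e i j]|%:R * v j else 0) - (e i j)%:R * v j.
  rewrite !mxE mulrBl; congr (_ - _); rewrite eq_sym.
  by case: eqP => [->|_]; rewrite ?mulr1n // mulr0n mul0r.
rewrite (eq_bigr _ (fun j _ => LE j)) sumrB -big_mkcond big_pred1_eq.
rewrite -sum1_card natr_sum big_mkcond mulr_suml -sumrB.
by apply: eq_bigr => j _; rewrite mulrBr inE; case: (e i j).
Qed.

(** Adding the double sum to its transpose completes the squares; the factor 2 appears because each
    edge is counted as two ordered pairs. *)
Lemma laplacian_form v :
  (\sum_i (v i)^* * \sum_j laplacian_mx R e i j * v j) *+ 2 =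
  \sum_i \sum_j (e i j)%:R * `|v i - v j| ^+ 2.
Proof.
under eq_bigr do rewrite laplacian_sum mulr_sumr.
rewrite mulr2n {1}exchange_big /= -big_split; apply: eq_bigr => i _ /=.
rewrite -big_split; apply: eq_bigr => j _ /=.
by rewrite (e_sym j i) normCK rmorphB /=; ring.
Qed.

Lemma laplacian_form_ge0 v :
  0 <= \sum_i (v i)^* * \sum_j laplacian_mx R e i j * v j.
Proof.
rewrite -(@pmulrn_lge0 _ _ 2) // laplacian_form.
by do 2!apply: sumr_ge0 => ? _; rewrite mulr_ge0 ?exprn_ge0.
Qed.

(** The quadratic form vanishes at [v], hence so does each of its nonnegative edge terms; [v] is
    then constant along edges, and so along paths. *)
Lemma laplacian_ker_connect v :
    (forall i, \sum_j laplacian_mx R e i j * v j = 0) ->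
  forall i j, connect e i j -> v i = v j.
Proof.
move=> Lv.
have ve i j : e i j -> v i = v j.
  have := laplacian_form v; rewrite big1 => [|k _]; last by rewrite Lv mulr0.
  rewrite mul0rn => /esym/eqP; rewrite psumr_eq0 => [/allP v0|k _]; last first.
    by apply: sumr_ge0 => l _; rewrite mulr_ge0 ?exprn_ge0.
  have /implyP/(_ isT) := v0 i (mem_index_enum _).
  rewrite psumr_eq0 => [/allP {}v0|l _]; last by rewrite mulr_ge0 ?exprn_ge0.
  have /implyP/(_ isT) := v0 j (mem_index_enum _).
  by move=> + eij; rewrite eij mul1r sqrf_eq0 normr_eq0 subr_eq0 => /eqP.
(* The level set of [v] through [i] is closed under adjacency. *)
move=> i j /(@closed_connect _ _ [pred l | v l == v i]) H.
have := H; rewrite !inE eqxx => /(_ _)/esym/eqP-> //.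
by move=> x y /ve; rewrite !inE => ->.
Qed.

End Laplacian.

(** * Frames whose Gram matrix is a Laplacian *)

Section LaplacianFrames.
Variables (R : realType) (d n : nat) (e : rel 'I_n) (Phi : 'I_n -> 'cV[R[i]]_d).
Hypothesis e_sym : symmetric e.
Hypothesis Phi_total : forall f, (forall i, inner f (Phi i) = 0) -> f = 0.
Hypothesis Phi_gram : forall i j, inner (Phi j) (Phi i) = laplacian_mx R e i j.

Lemma inner_synthesis (v : 'I_n -> R[i]) i :
  inner (\sum_j v j *: Phi j) (Phi i) = \sum_j laplacian_mx R e i j * v j.
Proof.
by rewrite inner_suml; apply: eq_bigr => j _; rewrite innerZl Phi_gram mulrC.
Qed.

(** The indicator of a component lies in the kernel of the Laplacian, so the sum is orthogonal to
    every [Phi p]. *)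
Lemma sum_component i : \sum_(l | connect e i l) Phi l = 0.
Proof.
apply: Phi_total => p.
rewrite big_mkcond (eq_bigr (fun l => (connect e i l)%:R *: Phi l)); last first.
  by move=> l _; case: ifP; rewrite ?scale1r ?scale0r.
rewrite inner_synthesis laplacian_sum big1 // => j _.
have [epj|] := boolP (e p j); last by rewrite mul0r.
rewrite (same_connect_r (sym_connect_sym e_sym) (connect1 epj)).
by rewrite subrr mulr0.
Qed.

(* By duality in linear algebra, a row vector lies in the row space of the analysis
   matrix as soon as it kills the kernel of that matrix, which consists of
   (conjugates of) vectors constant on components. *)
Lemma analysis_onto_diff i j : connect e i j ->
  exists f, forall l, inner f (Phi l) = (l == i)%:R - (l == j)%:R.
Proof.
move=> eij.
pose A : 'M[R[i]]_(d, n) := \matrix_(a, l) (Phi l a 0)^*.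
pose u : 'rV[R[i]]_n := delta_mx 0 i - delta_mx 0 j.
have : (u <= A)%MS.
  rewrite submxE; apply/eqP; move: (cokermx A) (mulmx_coker A) => K AK.
  apply/matrixP => x c; rewrite ord1 mulmxBl -!rowE !mxE.
  pose v l := (K l c)^*.
  suff : v i = v j by move=> /(can_inj (@conjCK _)) ->; rewrite subrr.
  apply: (laplacian_ker_connect e_sym) eij => p; rewrite -inner_synthesis.
  suff -> : \sum_l v l *: Phi l = 0 by rewrite inner0l.
  apply/matrixP => a b; rewrite ord1 summxE [RHS]mxE; apply: (can_inj (@conjCK _)).
  rewrite rmorph_sum rmorph0 /=.
  transitivity ((A *m K) a c); last by rewrite AK mxE.
  rewrite mxE.
  by apply: eq_bigr => l _; rewrite !mxE rmorphM /= conjCK mulrC.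
case/submxP => D uE; exists D^T => l.
have /matrixP/(_ 0 l) := uE; rewrite !mxE eqxx /= => ->.
by apply: eq_bigr => a _; rewrite !mxE.
Qed.

(** Reconstructing the [f] of [analysis_onto_diff] with any dual keeps just the two terms at [i] and
    [j]. *)
Lemma dual_diff i j : connect e i j ->
  exists2 f, (forall l, inner f (Phi l) = (l == i)%:R - (l == j)%:R) &
    forall Psi, dual_frames Phi Psi -> Psi i - Psi j = f.
Proof.
move=> /analysis_onto_diff [f fE]; exists f => // Psi [_ /(_ f) [fPsi _]].
have sum1 k : \sum_l (l == k)%:R *: Psi l = Psi k.
  rewrite (bigD1 k) //= eqxx scale1r big1 ?addr0 // => l /negPf ->.
  by rewrite scale0r.
rewrite [RHS]fPsi; under eq_bigr do rewrite fE scalerBl.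
by rewrite sumrB !sum1.
Qed.

Lemma dual_inner_diff Psi i j l : dual_frames Phi Psi -> connect e i j ->
  inner (Psi i) (Phi l) = (l == i)%:R - (l == j)%:R + inner (Psi j) (Phi l).
Proof.
move=> DPsi /dual_diff [f <- /(_ _ DPsi) <-].
by rewrite innerBl subrK.
Qed.

(** Write [g i j] for [inner (canonical_dual Phi i) (Phi j)]. This matrix is Hermitian, and
    [dual_inner_diff] gives [g i i = 1 + g j i] and [g j j = 1 + g i j]; these are conjugate, and
    the diagonal is real. *)
Lemma canonical_diag_connect i j : connect e i j ->
  inner (canonical_dual Phi i) (Phi i) = inner (canonical_dual Phi j) (Phi j).
Proof.
have [->//|ij] := eqVneq i j => eij.
have D := canonical_dualP Phi_total.
have diag_real k : (inner (canonical_dual Phi k) (Phi k))^*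
    = inner (canonical_dual Phi k) (Phi k).
  by rewrite -innerC -canonical_dual_inner_sym.
have eji : connect e j i by rewrite (sym_connect_sym e_sym).
rewrite -[LHS]diag_real (dual_inner_diff i D eij) (dual_inner_diff j D eji).
rewrite !eqxx (negPf ij) eq_sym (negPf ij) !subr0 rmorphD rmorph1 /= -innerC.
by rewrite -(canonical_dual_inner_sym Phi_total).
Qed.

(* The difference of two duals is constant on a component, where the phi_l sum to 0. *)
Lemma dual_component_trace Psi Psi' i :
    dual_frames Phi Psi -> dual_frames Phi Psi' ->
  \sum_(l | connect e i l) inner (Psi l) (Phi l) =
  \sum_(l | connect e i l) inner (Psi' l) (Phi l).
Proof.
move=> D D'; apply/eqP; rewrite -subr_eq0 -sumrB; apply/eqP.
rewrite (eq_bigr (fun l => inner (Psi i - Psi' i) (Phi l))) => [|l eil].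
  by rewrite -inner_sumr sum_component innerC inner0l rmorph0.
rewrite innerBl (dual_inner_diff l D eil) (dual_inner_diff l D' eil).
by rewrite opprD addrACA subrr add0r.
Qed.

Lemma canonical_optimal1 : spectrally_optimal1 Phi (canonical_dual Phi).
Proof.
have D := canonical_dualP Phi_total; split=> //.
apply: (rho_frame_min D) => Psi DPsi.
apply: bigmax_le => [|_ /cards1P [i ->]]; first exact: rho_dual_ge0.
rewrite spectral_radius1.
have C0 : (0 : R) < #|connect e i|%:R.
  by rewrite ltr0n; apply/card_gt0P; exists i; exact: connect0.
have sumC (x : R) : \sum_(l | connect e i l) x = #|connect e i|%:R * x.
  by rewrite sumr_const mulr_natl.
(* Multiplying by the size of the component allows a comparison of sums: the largest modulus is at
   least the average. *)
rewrite -(ler_pM2l C0) -[in leRHS]sumC.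
apply: (@le_trans _ _ (cmod (\sum_(l | connect e i l) inner (Psi l) (Phi l)))).
  (* For the canonical dual all summands are equal, so the triangle inequality loses nothing. *)
  rewrite (dual_component_trace i DPsi D) le_eqVlt; apply/orP; left; apply/eqP.
  rewrite (eq_bigr (fun=> inner (canonical_dual Phi i) (Phi i))); last first.
    by move=> l /canonical_diag_connect ->.
  by rewrite sumr_const cmodMn.
apply: (le_trans (cmod_sum _ _)); apply: ler_sum => l _.
by rewrite -spectral_radius1 rho_dual_ge // cards1.
Qed.

(* For every dual, psi_i - psi_j is fixed by the error operator of {i, j}. *)
Lemma rho_dual2_ge1 Psi i j : dual_frames Phi Psi -> connect e i j -> i != j ->
  1 <= rho_dual 2 Phi Psi.
Proof.
move=> DPsi eij ij; have [f fE /(_ _ DPsi) Pf] := dual_diff eij.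
apply: le_trans (rho_dual_ge Phi Psi (Lam := [set i; j]) _); last first.
  by rewrite cards2 ij.
rewrite -[leLHS]cmod1; apply: (spectral_radius_ge (f := f)).
  rewrite err_opE big_setU1 ?inE //= big_set1 !fE !eqxx (negPf ij) eq_sym (negPf ij).
  by rewrite subr0 sub0r scaleN1r !scale1r.
apply: contraTneq isT => f0; have := fE i.
by rewrite f0 inner0l eqxx (negPf ij) subr0 => /esym/eqP; rewrite oner_eq0.
Qed.

Hypothesis e_irr : irreflexive e.
Hypothesis d_gt0 : (0 < d)%N.

(** Without edges the Laplacian is 0, so every [Phi i] is orthogonal to the whole family and
    vanishes; totality then fails in positive dimension. *)
Lemma exists_edge : exists i j, e i j.
Proof.
have [[[i j] /= eij]|none] := pselect (exists p : 'I_n * 'I_n, e p.1 p.2).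
  by exists i, j.
have e0 i j : e i j = false by apply/negP => eij; apply: none; exists (i, j).
have Phi0 i : Phi i = 0.
  apply: Phi_total => j; rewrite Phi_gram !mxE e0 subr0.
  by rewrite eq_card0 ?mul0rn // => l; rewrite inE e0.
have : (const_mx 1 : 'cV[R[i]]_d) = 0.
  by apply: Phi_total => i; rewrite Phi0 innerC inner0l rmorph0.
move/matrixP/(_ (Ordinal d_gt0) 0); rewrite !mxE => /eqP.
by rewrite oner_eq0.
Qed.

Lemma canonical_optimal2 :
  spectrally_optimal2 Phi (canonical_dual Phi) /\ rho_frame 2 Phi = 1.
Proof.
have D := canonical_dualP Phi_total.
have [i [j eij]] := exists_edge.
have ij : i != j by apply: contraTneq eij => ->; rewrite e_irr.
have ge1 Psi : dual_frames Phi Psi -> 1 <= rho_dual 2 Phi Psi.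
  by move=> DPsi; exact: rho_dual2_ge1 DPsi (connect1 eij) ij.
have le1 := canonical_rho_dual_le1 Phi_total 2.
have min2 : rho_dual 2 Phi (canonical_dual Phi) = rho_frame 2 Phi.
  by apply: (rho_frame_min D) => Psi /ge1; exact: le_trans.
split; first by split=> //; exact: canonical_optimal1.
by rewrite -min2; apply: le_anti; rewrite le1 ge1.
Qed.

End LaplacianFrames.

(** * From the spectral construction to the Gram matrix and totality *)

Section GraphFrames.
Variables (R : realType) (n m : nat) (e : rel 'I_n) (Phi : 'I_n -> 'cV[R[i]]_m).
Hypothesis e_sym : symmetric e.

Lemma graph_frame_gram_total : is_graph_frame e Phi ->
  (forall i j, inner (Phi j) (Phi i) = laplacian_mx R e i j) /\
  (forall f, (forall i, inner f (Phi i) = 0) -> f = 0).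
Proof.
move=> [le_mn [M [lam [/unitarymxP MM LE lam0 PhiE]]]].
have MM' := mulmx1C MM.
have orth a b : \sum_i (M i a)^* * M i b = (a == b)%:R.
  by have /matrixP/(_ a b) := MM'; rewrite !mxE => <-; apply: eq_bigr => i _; rewrite !mxE.
have PhiiE i a : Phi i a 0 =
    sqrtC (lam 0 (widen_ord le_mn a)) * (M i (widen_ord le_mn a))^*.
  by rewrite PhiE -mulmxA mul_diag_mx -colE !mxE.
(* [lam 0 a] is the Laplacian form at column [a] of [M]. Its sign is needed because [sqrtC x] times
   its conjugate is the modulus of [x]. *)
have lam_ge0 a : 0 <= lam 0 a.
  suff -> : lam 0 a = \sum_i (M i a)^* * \sum_j laplacian_mx R e i j * M j a.
    exact: laplacian_form_ge0.
  have MLM : laplacian_mx R e *m M = M *m diag_mx lam.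
    by rewrite LE -mulmxA MM' mulmx1.
  have LME i : \sum_j laplacian_mx R e i j * M j a = M i a * lam 0 a.
    by have /matrixP/(_ i a) := MLM; rewrite mul_mx_diag !mxE.
  under eq_bigr do rewrite LME mulrA.
  by rewrite -mulr_suml orth eqxx mul1r.
split=> [i j|f f0].
  rewrite LE mxE; under [RHS]eq_bigr do rewrite mul_mx_diag !mxE.
  (* The positions from [m] on carry the eigenvalue 0, so dropping their columns leaves the Gram
     matrix unchanged. *)
  rewrite (bigID (fun a : 'I_n => (a < m)%N)) /= [X in _ + X]big1 ?addr0; last first.
    by move=> a /negPf am; have := lam0 a; rewrite am => /negbFE/eqP ->; rewrite mulr0 mul0r.
  rewrite (big_ord_narrow le_mn); apply: eq_bigr => a _.
  rewrite !PhiiE rmorphM /= conjCK mulrACA -normCK ger0_norm ?sqrtC_ge0 // sqrtCK.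
  by ring.
apply/matrixP => b x; rewrite ord1 mxE {x}; apply/eqP.
have sb : (sqrtC (lam 0 (widen_ord le_mn b)))^* != 0.
  by rewrite conjC_eq0 sqrtC_eq0 lam0 /=.
suff : f b 0 * (sqrtC (lam 0 (widen_ord le_mn b)))^* = 0.
  by move/eqP; rewrite mulf_eq0 (negPf sb) orbF.
(* Summing the coefficients of [f] against column [b] of [M] isolates [f b 0], by orthonormality, up
   to a nonzero square root. *)
have coef a : \sum_i (M i (widen_ord le_mn b))^* * (f a 0 * (Phi i a 0)^*) =
    f a 0 * (sqrtC (lam 0 (widen_ord le_mn a)))^* * (b == a)%:R.
  rewrite -[b == a]/(widen_ord le_mn b == widen_ord le_mn a) -orth mulr_sumr.
  by apply: eq_bigr => i _; rewrite PhiiE rmorphM /= conjCK; ring.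
have : \sum_i (M i (widen_ord le_mn b))^* * inner f (Phi i) = 0.
  by rewrite big1 // => i _; rewrite f0 mulr0.
rewrite (eq_bigr _ (fun i _ => mulr_sumr _ _ _ _)) exchange_big /=.
rewrite (eq_bigr _ (fun a _ => coef a)) (bigD1 b) //= eqxx mulr1 big1 ?addr0 //.
by move=> a ab; rewrite eq_sym (negPf ab) mulr0.
Qed.

End GraphFrames.

(** * The optimality theorem for graph frames *)

Theorem theorem4p4 (R : realType) (n k : nat) (e : rel 'I_n)
    (e_sym : symmetric e) (e_irr : irreflexive e)
    (k_gt1 : (1 < k)%N) (k_ltn : (k < n)%N)
    (e_comp : n_comp e 'I_n = k)
    (Phi : 'I_n -> 'cV[R[i]]_(n - k)) (Phi_G : is_graph_frame e Phi) :
  spectrally_optimal2 Phi (canonical_dual Phi) /\ rho_frame 2 Phi = 1.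
Proof.
have [gram total] := graph_frame_gram_total e_sym Phi_G.
by apply: (canonical_optimal2 e_sym total gram e_irr); rewrite subn_gt0.
Qed.
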